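(* Let $\mu_k>10$. For all even $N>2\mu_k$ (so the bounds are uniform in $N$), $$\|(\mathcal{L}_k^{(N)})^{-1}\|_{B(\ell^1)}\le C(\mu_k)=\begin{cases}1.612+0.1,&\mu_k\in(10,100],\\1.472+0.01,&\mu_k\in(100,1000],\\1.454+0.001,&\mu_k>1000.\end{cases}$$
   Context: $\mu_k$ is a real number. $\mathcal{L}_k^{(N)}$ is the $(N+1)\times(N+1)$ matrix whose first row is $(1,-2,2,-2,\dots,2(-1)^N)$, whose first column is $(1,\mu_k,0,\dots,0)^T$, and whose lower-right $N\times N$ block (rows and columns $2,\dots,N+1$) is the tridiagonal matrix with diagonal entries $2,4,\dots,2N$, superdiagonal entries $-\mu_k$ and subdiagonal entries $\mu_k$. It is invertible. For an $(N+1)\times(N+1)$ matrix $A$ with entries $a_{j,n}$, $$\|A\|_{B(\ell^1)}=\max\left\{|a_{1,1}|+2\sum_{j=2}^{N+1}|a_{j,1}|,\ \sup_{n>1}\left(\tfrac12|a_{1,n}|+\sum_{j=2}^{N+1}|a_{j,n}|\right)\right\}.$$ *)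

(* Defs.v *)
From mathcomp Require Import all_boot all_order all_algebra.
From mathcomp Require Import reals.

Set Implicit Arguments.
Unset Strict Implicit.
Unset Printing Implicit Defensive.

Import Order.TTheory GRing.Theory Num.Theory.

Local Open Scope ring_scope.

(* Rows and columns are numbered from 0 to N instead of from 1 to N+1, so for
   i >= 1 the diagonal entry of row i is 2i, and the entry mu in row 1 of the
   first column is covered by the subdiagonal case. *)
Definition Lmx (R : realType) (mu : R) (N : nat) : 'M[R]_N.+1 :=
  \matrix_(i < N.+1, j < N.+1)
    if i == 0%N :> nat then
      if j == 0%N :> nat then 1 else 2 * (-1) ^+ j
    else if j == i :> nat then 2 * i%:R
    else if j == i.+1 :> nat then - mu
    else if i == j.+1 :> nat then mu
    else 0.

(* The supremum over the columns other than the first is a finite maximum of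
   nonnegative numbers, so the default value 0 has no effect. *)
Definition Bl1_norm (R : realType) (N : nat) (A : 'M[R]_N.+1) : R :=
  Num.max
    (`|A ord0 ord0| + 2 * \sum_(j < N.+1 | (0 < j)%N) `|A j ord0|)
    (\big[Num.max/0]_(n < N.+1 | (0 < n)%N)
       (2^-1 * `|A ord0 n| + \sum_(j < N.+1 | (0 < j)%N) `|A j n|)).

(* Only meaningful for mu > 10. *)
Definition Cbound (R : realType) (mu : R) : R :=
  if mu <= 100 then 1612 / 1000 + 1 / 10
  else if mu <= 1000 then 1472 / 1000 + 1 / 100
  else 1454 / 1000 + 1 / 1000.

(* Main.v *)
Require Import Defs.
From mathcomp Require Import all_boot all_order all_algebra.
From mathcomp Require Import reals.
From mathcomp Require Import ring lra zify.
Import Order.TTheory GRing.Theory Num.Theory.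
Local Open Scope ring_scope.

(** The rows of index [i >= 1] of the system [L x = y] read
      [mu x_{i-1} + 2 i x_i - mu x_{i+1} = y_i],   [x_{N+1} = 0].
    Up to the sign [(-1)^i] in one of them, the homogeneous equation is the
    recurrence of the modified Bessel functions of argument [mu]: it has the
    solutions [k_i] ([growing], like [K_i(mu)]) and [(-1)^i b_i] ([homog], with
    [b = decaying] like [I_i(mu)], truncated by [b_{N+1} = 0]), with [k] and
    [b] positive.

    Row 0 is the functional [B(x) = x_0 + 2 sum_j (-1)^j x_j].  With
      [||x|| = |x_0| / 2 + sum_{j>=1} |x_j|],
    the norm of the theorem is the maximum of [2 ||column 0||] and of the
    [||column n||], [n >= 1]; moreover [|B(x)| <= 2 ||x||], with equality at
    [homog], all of whose terms contribute with the same sign.  So column 0 of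
    the inverse, the multiple of [homog] on which [B] is 1, has
    [2 ||column 0|| = 1] ([half_norm_column0]).

    For [n >= 1], let [g] be the Green function that follows [k] before [n] and
    [homog] from [n] on ([green]).  It satisfies every row of [L x = e_n] but
    row 0, so column [n] is [g - (B(g) / B(homog)) homog].  Since
    [2 ||homog|| = B(homog)], the correction is no larger than [||g||], whence
    [||column n|| <= 2 ||g||] ([half_norm_column]).

    It remains to bound [||g||] by [7/10] ([half_norm_green]), which gives the
    bound [7/5], smaller than the three constants.  The peak value is
      [g_n = 1 / (2n + mu k_{n-1}/k_n + mu b_{n+1}/b_n)].
    Before [n] the terms are at most [g_n], because [k] increases; after [n],
    the recurrence telescopes to
      [sum_{i>n} b_i <= mu (b_n + b_{n+1}) / (2 (n+1))].
    Comparing with the denominator of [g_n] leaves, essentially,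
      [1/2 + mu / (2 (n+1)) <= (2/5) n + (7/10) mu k_{n-1}/k_n].
    As [k_n <= (1 + 2 (n-1) / mu) k_{n-1}], the last term dominates when
    [2 (n-1) <= mu]; otherwise the left-hand side is at most [3/2] while
    [n >= 6]. *)

(** * Two solutions of the homogeneous recurrence *)

Fixpoint linrec {R : realType} (a : nat -> R) (x0 x1 : R) (m : nat) : R :=
  match m with
  | 0 => x0
  | m'.+1 => if m' is m''.+1
             then linrec a x0 x1 m'' + a m'' * linrec a x0 x1 m' else x1
  end.

Lemma linrecSS (R : realType) (a : nat -> R) (x0 x1 : R) m :
  linrec a x0 x1 m.+2 = linrec a x0 x1 m + a m * linrec a x0 x1 m.+1.
Proof. by []. Qed.

Lemma linrec_gt0 (R : realType) (a : nat -> R) (x0 x1 : R) (n : nat) :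
  (forall i, (i < n)%N -> 0 < a i) -> 0 <= x0 -> 0 < x1 ->
  0 < linrec a x0 x1 n.+1.
Proof.
move=> a_gt0 x0_ge0 x1_gt0.
suff H m : (m <= n)%N -> 0 < linrec a x0 x1 m.+1 /\ 0 <= linrec a x0 x1 m.
  by have [] := H n (leqnn n).
elim: m => [//|m IHm ltmn]; have [xS_gt0 x_ge0] := IHm (ltnW ltmn).
by rewrite linrecSS ltr_wpDl ?mulr_gt0 ?a_gt0 // ltW.
Qed.

Section Solutions.
Variables (R : realType) (mu : R) (N : nat).
Hypothesis mu_gt0 : 0 < mu.

(** The initial values [k_0 = k_1] make [k] monotone from the start: with
    [k_0 = 0], [k_2 = (2 / mu) k_1] would be smaller than [k_1] for [mu > 2]. *)
Definition growing := linrec (fun m => 2 * m.+1%:R / mu) 1 1.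

(** The recurrence is run downwards, from [b_{N+1} = 0] and [b_N = 1]: in the
    form [b_{i-1} = b_{i+1} + (2 i / mu) b_i] it propagates positivity. *)
Definition decaying (i : nat) :=
  linrec (fun m => 2 * (N - m)%:R / mu) 0 1 (N.+1 - i).

Lemma growing_rec i : (0 < i)%N ->
  mu * growing i.+1 = mu * growing i.-1 + 2 * i%:R * growing i.
Proof.
case: i => // i _; rewrite /growing linrecSS /= mulrDr; congr (_ + _).
by field; rewrite gt_eqF.
Qed.

(** The upper bound is what makes the induction go through: the increments
    [d_i = k_{i+1} - k_i] satisfy [mu d_{i+1} = 2 (i+1) k_{i+1} - mu d_i], which
    is at most [2 (i+1) k_{i+1}] if [d_i >= 0], and nonnegative if moreover
    [mu d_i <= 2 i k_i]. *)
Lemma growing_bounds i :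
  [/\ 0 < growing i, growing i <= growing i.+1
    & mu * growing i.+1 <= (mu + 2 * i%:R) * growing i].
Proof.
elim: i => [|i [k_gt0 k_le k_ub]]; first by rewrite /growing /=; split; lra.
have := growing_rec i.+1 (ltn0Sn i); rewrite /= => rec.
have kS_gt0 : 0 < growing i.+1 by lra.
have ik : i%:R * growing i <= i%:R * growing i.+1 by rewrite ler_wpM2l.
have mk : mu * growing i <= mu * growing i.+1 by rewrite ler_pM2l.
rewrite -[i.+1%:R]natr1 in rec *.
by split=> //; first rewrite -(ler_pM2l mu_gt0); lra.
Qed.

Lemma decaying_rec i : (0 < i <= N)%N ->
  mu * decaying i.-1 = mu * decaying i.+1 + 2 * i%:R * decaying i.
Proof.
case: i => // i /= leiN; rewrite /decaying.
have -> : (N.+1 - i = (N - i.+1).+2)%N by lia.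
have -> : (N.+1 - i.+1 = (N - i.+1).+1)%N by lia.
have -> : (N.+1 - i.+2 = N - i.+1)%N by lia.
rewrite linrecSS subKn // mulrDr; congr (_ + _).
by field; rewrite gt_eqF.
Qed.

Lemma decaying_end : decaying N.+1 = 0.
Proof. by rewrite /decaying subnn. Qed.

Lemma decaying_gt0 i : (i <= N)%N -> 0 < decaying i.
Proof.
move=> leiN; rewrite /decaying subSn //.
apply: linrec_gt0 => // m ltm; rewrite divr_gt0 ?mulr_gt0 ?ltr0n //; lia.
Qed.

Lemma decaying_ge0 i : (i <= N.+1)%N -> 0 <= decaying i.
Proof.
rewrite leq_eqVlt => /predU1P[->|ltiN]; first by rewrite decaying_end.
exact/ltW/decaying_gt0.
Qed.

(** The recurrence gives [2 i b_i = mu (b_{i-1} - b_{i+1})], whose right-hand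
    side telescopes, and [i >= n+1] in the sum. *)
Lemma sum_decaying n : (n <= N)%N ->
  2 * n.+1%:R * \sum_(n.+1 <= i < N.+1) decaying i
    <= mu * (decaying n + decaying n.+1).
Proof.
move=> lenN.
(* The sign turns the increasing-index telescope into b_{i-1} - b_{i+1}. *)
pose f i := - mu * (decaying i.-1 + decaying i).
have telesc : \sum_(n.+1 <= i < N.+1) 2 * i%:R * decaying i = f N.+1 - f n.+1.
  rewrite -telescope_sumr //; apply: eq_big_nat => i /andP[ltni leiN].
  have /decaying_rec : (0 < i <= N)%N by lia.
  by rewrite /f /=; lra.
apply: (@le_trans _ _ (\sum_(n.+1 <= i < N.+1) 2 * i%:R * decaying i)).
  rewrite mulr_sumr; apply: ler_sum_nat => i /andP[ltni leiN].
  by rewrite ler_pM2r ?decaying_gt0 // ler_pM2l // ler_nat.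
rewrite telesc /f /= decaying_end.
have := mulr_gt0 mu_gt0 (decaying_gt0 N (leqnn N)); nra.
Qed.

(** Each term is at most [k_n]; the term of index 0 counts for a half. *)
Lemma sum_growing n :
  2^-1 * growing 0 + \sum_(1 <= i < n.+1) growing i
    <= (n%:R + 2^-1) * growing n.
Proof.
elim: n => [|n IHn]; first by rewrite big_geq // addr0 add0r.
have [_ k_le _] := growing_bounds n.
rewrite big_nat_recr //= -[n.+1%:R]natr1.
have : (n%:R + 2^-1) * growing n <= (n%:R + 2^-1) * growing n.+1.
  by rewrite ler_wpM2l ?addr_ge0 ?invr_ge0.
lra.
Qed.

(** * The boundary row and the tridiagonal rows *)

Definition boundary (f : nat -> R) :=
  f 0 + 2 * \sum_(1 <= j < N.+1) (-1) ^+ j * f j.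

Definition interior (f : nat -> R) (i : nat) :=
  mu * f i.-1 + 2 * i%:R * f i - mu * f i.+1.

Lemma Lmx_mul_row0 (f : nat -> R) (i : 'I_N.+1) : i = 0 :> nat ->
  \sum_(j < N.+1) Lmx mu N i j * f j = boundary f.
Proof.
move=> i0; rewrite big_ord_recl mxE i0 /= mul1r; congr (_ + _).
rewrite mulr_sumr big_add1 big_mkord; apply: eq_bigr => j _.
by rewrite mxE i0 /= mulrA.
Qed.

(** Row [N] has no superdiagonal entry; the convention [f_{N+1} = 0] lets it
    follow the same formula as the other rows. *)
Lemma Lmx_mul_rowS (f : nat -> R) (i : 'I_N.+1) : (0 < i)%N -> f N.+1 = 0 ->
  \sum_(j < N.+1) Lmx mu N i j * f j = interior f i.
Proof.
move=> i_gt0 fN.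
have pick (a : nat) (c : R) : (a <= N)%N ->
  \sum_(j < N.+1) (if j == a :> nat then c else 0) * f j = c * f a.
  move=> leaN; rewrite (bigD1 (Ordinal (leaN : (a < N.+1)%N))) //= eqxx.
  by rewrite big1 ?addr0 // => j; rewrite -val_eqE /= => /negPf->; rewrite mul0r.
have pickS (c : R) : \sum_(j < N.+1) (if j == i.+1 :> nat then c else 0) * f j
    = c * f i.+1.
  have [ltiN|geiN] := ltnP i N; first exact: pick.
  have -> : i.+1 = N.+1 by have := ltn_ord i; lia.
  rewrite fN mulr0 big1 // => j _.
  by rewrite ltn_eqF ?mul0r.
rewrite /interior -(pick i.-1 mu) -?(pick i (2 * i%:R)); last 2 first.
- by rewrite -ltnS.
- by have := ltn_ord i; lia.
rewrite -mulNr -pickS -!big_split /=; apply: eq_bigr => j _.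
rewrite mxE -!mulrDl; congr (_ * _).
have -> : (j == i.-1 :> nat) = (i == j.+1 :> nat) by lia.
have -> : (i == 0 :> nat) = false by lia.
have [->|nij] := eqVneq (j : nat) i.
  have -> : (i == i.+1 :> nat) = false by lia.
  by rewrite add0r addr0.
have [->|nijS] := eqVneq (j : nat) i.+1.
  have -> : (i == i.+2 :> nat) = false by lia.
  by rewrite !add0r.
by rewrite !addr0.
Qed.

Lemma boundaryB (f g : nat -> R) (c : R) :
  boundary (fun j => f j - c * g j) = boundary f - c * boundary g.
Proof.
have -> : boundary f - c * boundary g = (f 0 - c * g 0)
    + 2 * (\sum_(1 <= j < N.+1) (-1) ^+ j * f j
           - c * \sum_(1 <= j < N.+1) (-1) ^+ j * g j).
  by rewrite /boundary; ring.
rewrite /boundary [c * \sum_(1 <= j < N.+1) _]mulr_sumr -sumrB.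
by congr (_ + 2 * _); apply: eq_bigr => j _; ring.
Qed.

Lemma interiorB (f g : nat -> R) (c : R) (i : nat) :
  interior (fun j => f j - c * g j) i = interior f i - c * interior g i.
Proof. by rewrite /interior; ring. Qed.

(** * The norm of a column and the boundary functional *)

(** In [Bl1_norm], column 0 enters with twice this value and the other columns
    with this value itself. *)
Definition half_norm (f : nat -> R) :=
  2^-1 * `|f 0| + \sum_(1 <= j < N.+1) `|f j|.

Lemma boundary_le (f : nat -> R) : `|boundary f| <= 2 * half_norm f.
Proof.
rewrite /boundary /half_norm mulrDr mulrA divff ?pnatr_eq0 // mul1r.
apply: le_trans (ler_normD _ _) _; rewrite lerD2l normrM normr_nat ler_pM2l //.
apply: le_trans (ler_norm_sum _ _ _) _.
by apply: ler_sum => j _; rewrite normrM normrX normrN1 expr1n mul1r.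
Qed.

Lemma half_normB (f g : nat -> R) (c : R) :
  half_norm (fun j => f j - c * g j) <= half_norm f + `|c| * half_norm g.
Proof.
have -> : half_norm f + `|c| * half_norm g = 2^-1 * (`|f 0| + `|c| * `|g 0|)
    + \sum_(1 <= j < N.+1) (`|f j| + `|c| * `|g j|).
  by rewrite big_split -mulr_sumr /half_norm /=; ring.
apply: lerD; first by rewrite ler_pM2l ?invr_gt0 // -normrM ler_normB.
by apply: ler_sum => j _; rewrite -normrM ler_normB.
Qed.

Definition homog (i : nat) : R := (-1) ^+ i * decaying i.

Lemma interior_homog i : (0 < i <= N)%N -> interior homog i = 0.
Proof.
case: i => // i /decaying_rec /= rec.
have -> : interior homog i.+1 = (-1) ^+ i * (mu * decaying i
    - (mu * decaying i.+2 + 2 * i.+1%:R * decaying i.+1)).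
  by rewrite /interior /homog /= !exprS; ring.
by rewrite rec subrr mulr0.
Qed.

(** The factor [(-1)^i] of [homog] cancels the one in [boundary], so that
    [boundary_le] is an equality here. *)
Lemma boundary_homog : boundary homog = 2 * half_norm homog.
Proof.
rewrite /boundary /half_norm mulrDr mulrA divff ?pnatr_eq0 // mul1r.
have norm_homog j : (j <= N)%N -> `|homog j| = decaying j.
  move=> lejN; rewrite /homog normrM normrX normrN1 expr1n mul1r.
  by rewrite gtr0_norm // decaying_gt0.
rewrite norm_homog // /homog expr0 mul1r; congr (_ + 2 * _).
apply: eq_big_nat => j /andP[_ lejN].
by rewrite norm_homog // mulrA -expr2 sqrr_sign mul1r.
Qed.

Lemma boundary_homog_gt0 : 0 < boundary homog.
Proof.
rewrite boundary_homog mulr_gt0 // ltr_wpDr ?sumr_ge0 // mulr_gt0 ?invr_gt0 //.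
by rewrite normr_gt0 /homog expr0 mul1r gt_eqF // decaying_gt0.
Qed.

(** * The Green function and the columns of the inverse *)

(** By the recurrence for [b], this is [mu (k_n b_{n-1} + k_{n-1} b_n)] for
    [1 <= n <= N], that is, up to sign, [mu] times the Casoratian of [k] and
    [homog].  The present form is the value at row [n] of [interior] on the
    numerators of [green n], hence the normalizing denominator. *)
Definition casoratian n := 2 * n%:R * growing n * decaying n
  + mu * growing n.-1 * decaying n + mu * growing n * decaying n.+1.

Definition green n i :=
  (if (i <= n)%N then growing i * decaying n
   else (-1) ^+ (i - n) * growing n * decaying i) / casoratian n.

Lemma casoratian_gt0 n : (n <= N)%N -> 0 < casoratian n.
Proof.
move=> lenN.
have [kn_gt0 _ _] := growing_bounds n; have [km_gt0 _ _] := growing_bounds n.-1.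
have bn_gt0 := decaying_gt0 n lenN.
have bS_ge0 := decaying_ge0 n.+1 lenN.
rewrite ltr_wpDr ?mulr_ge0 //; try exact: ltW.
rewrite ltr_wpDl ?mulr_gt0 //; last by rewrite !mulr_ge0 // ltW.
Qed.

(** Both branches of [green] agree at [n]; hence the recurrence at [n + 1], which
    involves the values from [n] on, sees only the decaying solution. *)
Lemma green_right n i : (n <= i)%N ->
  green n i = (-1) ^+ (i - n) * growing n * decaying i / casoratian n.
Proof.
rewrite /green leq_eqVlt => /predU1P[<-|ltni].
  by rewrite leqnn subnn expr0 mul1r.
by rewrite leqNgt ltni.
Qed.

Lemma interior_green n i : (n <= N)%N -> (0 < i <= N)%N ->
  interior (green n) i = (i == n)%:R.
Proof.
move=> nN iN; have := casoratian_gt0 n nN; rewrite /interior => W_gt0.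
have [ltin|ltni|->] := ltngtP i n.
- rewrite /green ltin (ltnW ltin) (leq_trans (leq_pred i) (ltnW ltin)).
  have := growing_rec i; case/andP: iN => -> _ /(_ isT) rec.
  transitivity ((mu * growing i.-1 + 2 * i%:R * growing i - mu * growing i.+1)
    * decaying n / casoratian n); first by ring.
  by rewrite rec subrr !mul0r.
- have leni : (n <= i.-1)%N by lia.
  rewrite !green_right ?(ltnW ltni) ?(leqW (ltnW ltni)) //.
  rewrite (_ : i.+1 - n = (i.-1 - n).+2)%N; last by lia.
  rewrite (_ : i - n = (i.-1 - n).+1)%N; last by lia.
  have rec := decaying_rec i iN.
  transitivity ((-1) ^+ (i.-1 - n) * growing n * (mu * decaying i.-1
    - (mu * decaying i.+1 + 2 * i%:R * decaying i)) / casoratian n).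
    by rewrite !exprS; ring.
  by rewrite rec subrr mulr0 mul0r.
rewrite (green_right n n.+1) // subSnn /green leqnn leq_pred.
transitivity (casoratian n / casoratian n); last by rewrite divff ?gt_eqF.
by rewrite /casoratian; ring.
Qed.

Lemma green_end n : (n <= N)%N -> green n N.+1 = 0.
Proof. by move=> lenN; rewrite green_right ?leqW // decaying_end mulr0 mul0r. Qed.

(** Subtracting a multiple of [homog] leaves the rows [i >= 1] unchanged and
    adjusts row 0, where the right-hand side is 1 for [n = 0] and 0 otherwise. *)
Definition column n (i : nat) : R :=
  green n i - (boundary (green n) - (n == 0)%:R) / boundary homog * homog i.

Lemma invmx_Lmx (i j : 'I_N.+1) : invmx (Lmx mu N) i j = column j i.
Proof.
pose X : 'M[R]_N.+1 := \matrix_(i, j) column j i.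
suff LX : Lmx mu N *m X = 1%:M.
  have [Lu _] := mulmx1_unit LX.
  by rewrite -[invmx _]mulmx1 -LX mulKmx // mxE.
apply/matrixP => {}i {}j; rewrite !mxE.
under eq_bigr do rewrite [X _ _]mxE.
have lejN : (j <= N)%N by rewrite -ltnS.
have [i0|i_gt0] := posnP i.
  rewrite (Lmx_mul_row0 (column j)) // boundaryB divfK; last first.
    exact/lt0r_neq0/boundary_homog_gt0.
  by rewrite opprB addrC subrK -val_eqE /= i0 eq_sym.
have iN : (0 < i <= N)%N by rewrite i_gt0 -ltnS /=.
rewrite (Lmx_mul_rowS (column j)) //; last first.
  by rewrite /column green_end // /homog decaying_end !mulr0 subrr.
by rewrite interiorB interior_green // interior_homog // mulr0 subr0.
Qed.

(** No index lies to the left of 0, so [green 0] is a multiple of [homog], and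
    column 0 is [homog / B(homog)]. *)
Lemma half_norm_column0 : 2 * half_norm (column 0) = 1.
Proof.
have B_gt0 := boundary_homog_gt0.
pose c := growing 0 / casoratian 0.
have col0 i : column 0 i = (boundary homog)^-1 * homog i.
  have g0 j : green 0 j = 0 - - c * homog j.
    by rewrite green_right // subn0 /homog /c; ring.
  have bg0 : boundary (green 0) = c * boundary homog.
    have -> : boundary (green 0) = boundary (fun j => 0 - - c * homog j).
      by rewrite /boundary g0; congr (_ + 2 * _); apply: eq_bigr => j _; rewrite g0.
    by rewrite (boundaryB (fun=> 0)) /boundary big1 ?mulr0 => [|j _]; ring.
  rewrite /column bg0 g0 eqxx [X in X / _](_ : _ = c * boundary homog - 1) //.
  by rewrite mulrBl mulfK ?lt0r_neq0 //; ring.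
have -> : half_norm (column 0) = (boundary homog)^-1 * half_norm homog.
  rewrite /half_norm mulrDr mulr_sumr !col0 normrM mulrCA gtr0_norm ?invr_gt0 //.
  congr (_ + _); apply: eq_bigr => j _.
  by rewrite col0 normrM gtr0_norm ?invr_gt0.
by rewrite mulrCA -boundary_homog mulVf // lt0r_neq0.
Qed.

(** The correction has norm
    [|B(g)| / B(homog) * ||homog|| = |B(g)| / 2 <= ||g||]. *)
Lemma half_norm_column n : (0 < n)%N ->
  half_norm (column n) <= 2 * half_norm (green n).
Proof.
case: n => // n _; have B_gt0 := boundary_homog_gt0.
apply: le_trans (half_normB _ _ _) _.
rewrite subr0 normrM normfV (gtr0_norm B_gt0) [2 * _]mulrDl mul1r lerD2l.
rewrite {1}boundary_homog invfM -!mulrA mulVf; last first.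
  by move/lt0r_neq0: B_gt0; rewrite boundary_homog mulf_eq0 => /norP[].
by rewrite mulr1 ler_pdivrMr // mulrC boundary_le.
Qed.

(** * The size of the Green function *)

(** Of the two regimes at the end, the first one uses that [k_{n-1} / k_n] is at
    least [1/2] for [n] up to about [mu / 2], and [mu > 10] to absorb the term
    [k_n / 2]; in the second one the diagonal entry [2 n] alone suffices. *)
Lemma half_norm_green n : 10 < mu -> (0 < n <= N)%N ->
  half_norm (green n) <= 7 / 10.
Proof.
move=> mu_gt10 /andP[n_gt0 lenN].
have W_gt0 := casoratian_gt0 n lenN.
have k_gt0 i : 0 < growing i by have [] := growing_bounds i.
have bn_gt0 := decaying_gt0 n lenN.
have bS_ge0 := decaying_ge0 n.+1 lenN.
have -> : half_norm (green n) = ((2^-1 * growing 0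
    + \sum_(1 <= i < n.+1) growing i) * decaying n
    + growing n * \sum_(n.+1 <= i < N.+1) decaying i) / casoratian n.
  rewrite /half_norm (big_cat_nat (n := n.+1)) //=.
  rewrite !mulrDl !mulr_suml mulr_sumr mulr_suml addrA.
  congr (_ + _ + _).
  - by rewrite /green /= gtr0_norm ?divr_gt0 ?mulr_gt0 ?decaying_gt0 // !mulrA.
  - apply: eq_big_nat => i /andP[_ lein]; rewrite /green -ltnS lein.
    by rewrite gtr0_norm ?divr_gt0 ?mulr_gt0.
  apply: eq_big_nat => i /andP[ltni leiN]; rewrite green_right 1?ltnW // -!mulrA.
  rewrite normrM normrX normrN1 expr1n mul1r gtr0_norm //.
  by rewrite !mulr_gt0 ?invr_gt0 ?decaying_gt0.
rewrite ler_pdivrMr // /casoratian.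
have sumk := sum_growing n; have sumb := sum_decaying n lenN.
set Sk := _ + _ in sumk *; set Sb := bigop.body _ _ _ in sumb *.
have [_ _] := growing_bounds n.-1; rewrite prednK // => k_ub.
have {}k_ub : mu * growing n <= (mu + 2 * (n%:R - 1)) * growing n.-1.
  by rewrite -(natrB _ n_gt0) subn1.
have n_ge1 : 1 <= n%:R :> R by rewrite ler1n.
have {}sumb : Sb <= mu / (2 * (n%:R + 1)) * (decaying n + decaying n.+1).
  by rewrite mulrAC ler_pdivlMr ?natr1 ?mulr_gt0 // mulrC.
have q_le : mu / (2 * (n%:R + 1)) <= mu / 4 by rewrite ler_pM2l // lef_pV2 ?posrE; lra.
set q := mu / (2 * (n%:R + 1)) in sumb q_le *.
(* The inequality between the coefficients of b_n; those of b_{n+1} compare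
   as 1/4 <= 7/10. *)
suff key : (n%:R + 2^-1 + q) * growing n
    <= 7 / 10 * (2 * n%:R * growing n + mu * growing n.-1).
  have := ler_wpM2r (ltW bn_gt0) sumk; have := ler_wpM2r (ltW bn_gt0) key.
  have := ler_wpM2l (ltW (k_gt0 n)) sumb.
  have kb_ge0 : 0 <= growing n * decaying n.+1 by rewrite mulr_ge0 // ltW.
  have := ler_wpM2r kb_ge0 q_le; have := mulr_ge0 (ltW mu_gt0) kb_ge0.
  lra.
have kn_gt0 := k_gt0 n; have km_gt0 := k_gt0 n.-1.
have nk : growing n <= n%:R * growing n by rewrite ler_peMl // ltW.
have muk : 10 * growing n <= mu * growing n by rewrite ler_pM2r // ltW.
have [n_small|n_large] := lerP (2 * (n%:R - 1)) mu.
  have k_half : mu * growing n <= 2 * mu * growing n.-1.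
    by apply: le_trans k_ub _; rewrite ler_pM2r //; lra.
  have := ler_wpM2r (ltW kn_gt0) q_le; lra.
have q_le1 : q <= 1 by rewrite ler_pdivrMr; lra.
have := ler_wpM2r (ltW kn_gt0) q_le1; have := mulr_gt0 mu_gt0 km_gt0.
have n_ge6 : 6 <= n%:R :> R by lra.
have := ler_wpM2r (ltW kn_gt0) n_ge6; lra.
Qed.

End Solutions.

(** * The norm of the inverse *)

Lemma sum_ord_pos (V : nmodType) (N : nat) (F : nat -> V) :
  \sum_(j < N.+1 | (0 < j)%N) F j = \sum_(1 <= j < N.+1) F j.
Proof. by rewrite big_mkcond big_ord_recl /= add0r big_add1 big_mkord. Qed.

Theorem corollary3p27 (R : realType) (mu : R) (hmu : 10 < mu)
    (N : nat) (hNeven : ~~ odd N) (hN : 2 * mu < N%:R) :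
  Bl1_norm (invmx (Lmx mu N)) <= Cbound mu.
Proof.
have mu_gt0 : 0 < mu by lra.
apply: (@le_trans _ _ (7 / 5)); last by rewrite /Cbound; do 2?case: ifP => _; lra.
have entry := invmx_Lmx R mu N mu_gt0.
rewrite /Bl1_norm ge_max; apply/andP; split.
  under eq_bigr do rewrite entry.
  rewrite entry (sum_ord_pos _ N (fun j => `|column R mu N 0 j|)).
  have := half_norm_column0 R mu N mu_gt0; rewrite /half_norm /=; lra.
apply: bigmax_le => [|n n_gt0]; first lra.
under eq_bigr do rewrite entry.
rewrite entry (sum_ord_pos _ N (fun j => `|column R mu N n j|)).
have nN : (0 < n <= N)%N by rewrite n_gt0 -ltnS /=.
have := half_norm_green R mu N mu_gt0 n hmu nN.
have := half_norm_column R mu N mu_gt0 n n_gt0; rewrite /half_norm /=; lra.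
Qed.
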